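(* Let $n\ge 2$ and let $P_n$ be the path on $n$ vertices. For an integer $k$ with $1 \le k \le n/2$, let $M(n,k)$ denote the smallest diameter of a graph obtained from $P_n$ by adding $k$ matching edges. Then $$M(n,k) \;\ge\; \frac{n}{2(k+1)} + \log_2(k+1) - 2 .$$
   Context: All graphs are simple, undirected and unweighted; the distance between two vertices is the number of edges on a shortest path, and the diameter is the maximum distance over all pairs of vertices. ''Adding $k$ matching edges'' to a graph means adding $k$ new edges (pairs of vertices not already adjacent) such that every vertex is incident to at most one of the new edges, i.e., the new edges form a matching. *)

(* Defs.v *)
From mathcomp Require Import all_boot all_order all_algebra.
From mathcomp Require Import reals exp.

Set Implicit Arguments.
Unset Strict Implicit.
Unset Printing Implicit Defensive.

Import Order.TTheory GRing.Theory Num.Theory.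

(* A simple graph on a finite type T is a symmetric irreflexive relation; the
   length of the path x :: p is size p, its number of edges. *)
Definition has_path (T : finType) (e : rel T) (x y : T) (d : nat) : bool :=
  [exists p : d.-tuple T, [&& path e x p, uniq (x :: p) & last x p == y]].

(* A path has fewer than #|T| edges, so searching d < #|T| loses nothing; the
   value is #|T| when y is not reachable from x. This does not happen in the
   graphs below, which all contain a spanning path. *)
Definition dist (T : finType) (e : rel T) (x y : T) : nat :=
  find (has_path e x y) (iota 0 #|T|).

Definition diam (T : finType) (e : rel T) : nat :=
  \max_(x : T) \max_(y : T) dist e x y.

Definition path_graph (n : nat) : rel 'I_n :=
  fun i j => (i.+1 == j :> nat) || (j.+1 == i :> nat).

Definition new_matching (T : finType) (e : rel T) (k : nat)
    (F : {set {set T}}) : bool :=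
  [&& #|F| == k,
      [forall A in F, [exists x, [exists y,
         [&& A == [set x; y], x != y & ~~ e x y]]]]
    & [forall v, #|[set A in F | v \in A]| <= 1]].

Definition add_edges (T : finType) (e : rel T) (F : {set {set T}}) : rel T :=
  fun x y => e x y || ([set x; y] \in F).

(* The relation "M(n,k) = m", a minimum over the possibly empty set of
   admissible F. For 1 <= k <= n/2 that set is empty only when (n, k) = (2, 1),
   since P_2 has no nonadjacent pair of vertices; see M_exists for n >= 3. *)
Definition is_M (n k m : nat) : Prop :=
  (exists2 F, new_matching (@path_graph n) k F
            & diam (add_edges (@path_graph n) F) = m) /\
  (forall F, new_matching (@path_graph n) k F ->
     m <= diam (add_edges (@path_graph n) F)).

Definition log2 (R : realType) (x : R) : R := (ln x / ln 2%:R)%R.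

Lemma new_matching_exists (n k : nat) : 2 < n -> k.*2 <= n ->
  exists F, new_matching (@path_graph n) k F.
Proof.
move=> n2 kn.
have hn : uphalf n + n./2 = n by rewrite uphalf_half -addnA addnn odd_double_half.
have hk : k <= n./2 by rewrite -(doubleK k) half_leq.
have hku : k <= uphalf n by rewrite (leq_trans hk) // uphalf_half leq_addl.
have u2 : 1 < uphalf n by case: n n2 {kn hn hk hku} => [|[|[|n]]].
have aP (i : 'I_k) : i < n.
  by apply: leq_trans (ltn_ord i) _; rewrite (leq_trans hk) // -[X in _ <= X]hn leq_addl.
have bP (i : 'I_k) : uphalf n + i < n.
  by rewrite -[X in _ < X]hn ltn_add2l (leq_trans (ltn_ord i)).
pose a i := Ordinal (aP i); pose b i := Ordinal (bP i).
pose E i := [set a i; b i].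
have EP (v : 'I_n) i j : v \in E i -> v \in E j -> i = j.
  have ik (l : 'I_k) := leq_trans (ltn_ord l) hku.
  rewrite !inE -!val_eqE /= => /orP[] /eqP-> /orP[] /eqP h; apply/val_inj => //=.
  - by have := ik i; rewrite h ltnNge leq_addr.
  - by have := ik j; rewrite -h ltnNge leq_addr.
  - exact: addnI h.
have Einj : injective E.
  by move=> i j ij; apply: (EP (a i)); rewrite -?ij !inE eqxx.
exists [set E i | i : 'I_k]; apply/and3P; split.
- by rewrite card_imset // card_ord.
- apply/forall_inP => _ /imsetP[i _ ->].
  apply/existsP; exists (a i); apply/existsP; exists (b i).
  rewrite eqxx -val_eqE /path_graph /=.
  have lt1 : i.+1 < uphalf n + i by apply: (leq_add u2 (leqnn i)).
  rewrite !negb_or (ltn_eqF lt1) (ltn_eqF (ltnW lt1)).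
  by rewrite (gtn_eqF (leqW (ltnW lt1))).
- apply/forallP => v; rewrite leqNgt; apply/negP => /card_gt1P[A [B []]].
  rewrite !inE => /andP[/imsetP[i _ ->] vi] /andP[/imsetP[j _ ->] vj].
  by rewrite (EP _ _ _ vi vj) eqxx.
Qed.

Lemma M_exists (n k : nat) : 2 < n -> k.*2 <= n -> exists m, is_M n k m.
Proof.
move=> n2 kn; have [F0 F0P] := new_matching_exists n2 kn.
have [F FP Fmin] := arg_minnP (fun F => diam (add_edges (@path_graph n) F)) F0P.
by exists (diam (add_edges (@path_graph n) F)); split=> //; exists F.
Qed.

(* Main.v *)
Require Import Defs.
From mathcomp Require Import all_boot all_order all_algebra.
From mathcomp Require Import reals exp convex interval_inference.
From mathcomp Require Import zify ring lra.

Import Order.TTheory GRing.Theory Num.Theory.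

(** Explore the graph from one vertex, layer by layer. Call a vertex of layer
    [t] jumped if its new edge leads back to layer [t - 1], and walked otherwise.
    A walked vertex has at most one path edge leading to the next layer (for
    [t > 0]), a jumped one at most two, and only walked vertices can be followed
    by a jumped one. Let [A t] be one more than the number of jumped vertices in
    the layers [0, ..., t]. Then layer [t + 1] has at most [2 A t] walked vertices,
    so [A (t + 2) <= A (t + 1) + 2 A t], whence [A t <= 2 ^ t]; also
    [A t <= k + 1], because each new edge produces at most one jumped vertex.
    Adding up the layers gives [n <= 2 (A 0 + ... + A (D - 1)) + A D] for
    diameter [D]. With [s] the integer part of [log2 (k + 1)], bound [A t] by
    [2 ^ t] for [t < s] and by [k + 1] beyond; the rounding in [s] is absorbed by
    the concavity of the logarithm. *)

(** Double counting: every [x] in [A] occurs in at least one summand. This later charges vertices of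
    a layer to their predecessors, and jumped vertices to new edges. *)
Lemma leq_card_witness (I T : finType) (r : I -> T -> bool)
    (B : {set I}) (A : {set T}) :
  (forall x, x \in A -> exists2 i, i \in B & r i x) ->
  #|A| <= \sum_(i in B) #|[set x in A | r i x]|.
Proof.
move=> rP; rewrite -sum1_card.
under [X in _ <= X]eq_bigr do rewrite -sum1_card.
under [X in _ <= X]eq_bigr => i _.
  under eq_bigl do rewrite inE.
  over.
rewrite (exchange_big_dep (mem A)) /=; last by move=> i x _ /andP[].
apply: leq_sum => x xA; have [i iB rix] := rP x xA.
by rewrite (bigD1 i) //= iB xA.
Qed.

(** * Distances and shortest paths *)

Section Distance.
Variables (T : finType) (e : rel T).

(** [dist] searches only simple paths with fewer than [#|T|] edges, so the walk is first shortened
    to such a path. *)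
Lemma dist_last (x : T) (p : seq T) :
  path e x p -> dist e x (last x p) <= size p.
Proof.
move=> /shortenP[q eq uq sub_qp].
have sqp : size q <= size p.
  by apply: uniq_leq_size sub_qp; case/andP: uq.
apply: leq_trans sqp.
have qT : size q < #|T|.
  by have := max_card (mem (x :: q)); rewrite (card_uniqP uq).
rewrite leqNgt; apply/negP => /(before_find 0).
rewrite nth_iota // add0n => /existsP[].
by exists (in_tuple q); rewrite eq uq /=.
Qed.

Lemma dist_pathP (x y : T) : connect e x y ->
  exists p, [/\ path e x p, last x p = y & size p = dist e x y].
Proof.
case/connectP=> p ep yE.
have : has (has_path e x y) (iota 0 #|T|).
  case/shortenP: ep yE => q eq uq _ ->.
  have qT : size q < #|T|.
    by have := max_card (mem (x :: q)); rewrite (card_uniqP uq).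
  apply/hasP; exists (size q); first by rewrite mem_iota.
  by apply/existsP; exists (in_tuple q); rewrite eq uq /=.
move=> hxy; have := nth_find 0 hxy.
rewrite has_find size_iota in hxy; rewrite nth_iota // add0n.
case/existsP=> q /and3P[eq _ /eqP lq].
by exists q; split=> //; rewrite size_tuple.
Qed.

Lemma dist_eq0 (x y : T) : connect e x y -> dist e x y = 0 -> y = x.
Proof. by case/dist_pathP=> p [_ <- <-] /size0nil ->. Qed.

Lemma dist_edge (x y z : T) : connect e x y -> e y z ->
  dist e x z <= (dist e x y).+1.
Proof.
case/dist_pathP=> p [ep py <-] eyz.
have := @dist_last x (rcons p z).
by rewrite rcons_path ep py last_rcons size_rcons; apply.
Qed.

Lemma dist_pred (x z : T) (t : nat) : connect e x z -> dist e x z = t.+1 ->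
  exists2 y, e y z & dist e x y = t.
Proof.
case/dist_pathP=> p [ep pz ps] dz; rewrite dz in ps.
case/lastP: p => // p w in ep pz ps *; rewrite last_rcons in pz.
rewrite {}pz size_rcons rcons_path in ep ps; case: ps => pt.
case/andP: ep => ep elz; exists (last x p) => //.
have cp : connect e x (last x p) by apply/connectP; exists p.
apply/eqP; rewrite eqn_leq -{1}pt dist_last //= -ltnS -dz.
exact: dist_edge.
Qed.
End Distance.

Lemma set2_inj (T : finType) (x y z : T) :
  y != x -> [set x; y] = [set x; z] -> y = z.
Proof.
move=> yx /setP/(_ y); rewrite !inE eqxx orbT (negPf yx) /= => /esym/eqP //.
Qed.

(** * Breadth-first layers of a graph with an added matching *)

Section Layers.
Variables (T : finType) (e : rel T) (k : nat) (F : {set {set T}}) (x : T).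
Hypothesis e_sym : symmetric e.
Hypothesis e_deg : forall y, #|[set z | e y z]| <= 2.
Hypothesis F_matching : new_matching e k F.
Hypothesis reach : forall y, connect (add_edges e F) x y.

Local Notation d := (dist (add_edges e F) x).

Definition jumped (t : nat) : {set T} :=
  [set y | (d y == t) && [exists z, ([set z; y] \in F) && ((d z).+1 == t)]].

Definition walked (t : nat) : {set T} := [set y | d y == t] :\: jumped t.

Lemma matching_unique (y : T) (A B : {set T}) :
  A \in F -> B \in F -> y \in A -> y \in B -> A = B.
Proof.
move=> AF BF yA yB; case/and3P: F_matching => _ _ /forallP/(_ y)/card_le1_eqP.
by apply; rewrite inE ?AF ?BF.
Qed.

Lemma jumpedP (t : nat) (y : T) : reflect
  (exists z, [/\ [set z; y] \in F, d y = (d z).+1 & t = (d z).+1])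
  (y \in jumped t).
Proof.
rewrite inE; apply: (iffP andP) => [[/eqP dy /existsP[z /andP[zyF /eqP dz]]]|].
  by exists z; rewrite dz.
by case=> z [zyF -> ->]; split=> //; apply/existsP; exists z; rewrite zyF /=.
Qed.

Lemma card_layer (t : nat) :
  #|[set y | d y == t]| = #|jumped t| + #|walked t|.
Proof.
rewrite -(cardsID (jumped t)); congr (_ + _); apply: eq_card => y.
by rewrite !inE andbA andbb.
Qed.

Lemma jumped0 : jumped 0 = set0.
Proof. by apply/setP => y; rewrite in_set0; apply/jumpedP => -[z []]. Qed.

Lemma card_jumpedS (t : nat) : #|jumped t.+1| <= #|walked t|.
Proof.
pose r z y := ([set z; y] \in F) && ((d z).+1 == d y).
apply: (@leq_trans (\sum_(z in walked t) #|[set y in jumped t.+1 | r z y]|)).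
  apply: leq_card_witness => y /jumpedP[z [zyF dy [dz]]].
  exists z; last by rewrite /r zyF dy /=.
  (* If [z] were jumped, its new edge would lead back to some [w]. The matching makes this the edge
     to [y], yet [w] lies one layer before [z] and [y] one layer after. *)
  rewrite !inE dz eqxx andbT; apply/negP => /andP[_].
  case/existsP=> w /andP[wzF /eqP dw].
  have : w \in [set z; y].
    by rewrite -(matching_unique z _ _ wzF zyF) ?inE ?eqxx ?orbT.
  by rewrite !inE => /orP[] /eqP wE; rewrite wE ?dy -dz in dw; lia.
rewrite -sum1_card; apply: leq_sum => z _.
apply/card_le1_eqP => y y'; rewrite !inE.
move=> /andP[_ /andP[zyF /eqP dy]] /andP[_ /andP[zyF' /eqP dy']].
apply: (set2_inj _ z); first by apply/eqP => yz; move: dy dy'; rewrite yz; lia.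
by apply: (matching_unique z); rewrite // !inE eqxx.
Qed.

Lemma walked_pred (t : nat) (y : T) : y \in walked t.+1 ->
  exists2 z, e z y & d z = t.
Proof.
rewrite 2!inE => /andP[yJ /eqP dy].
have [z] := dist_pred _ _ _ _ _ (reach y) dy.
case/orP => [ezy dz|zyF dz]; first by exists z.
by case/jumpedP: yJ; exists z; rewrite dy dz.
Qed.

Lemma card_walked0 : #|walked 0| <= 1.
Proof.
apply: leq_trans (_ : #|[set x]| <= 1); last by rewrite cards1.
apply/subset_leq_card/subsetP => y; rewrite 3!inE => /andP[_ /eqP dy].
by rewrite (dist_eq0 _ _ _ _ (reach y) dy).
Qed.

Lemma card_walked1 : #|walked 1| <= 2.
Proof.
apply: leq_trans (e_deg x); apply/subset_leq_card/subsetP => y.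
case/walked_pred=> z ezy dz.
by rewrite inE -(dist_eq0 _ _ _ _ (reach z) dz).
Qed.

Lemma card_walkedSS (t : nat) :
  #|walked t.+2| <= #|walked t.+1| + 2 * #|jumped t.+1|.
Proof.
pose N z := [set y in walked t.+2 | e z y].
have N_sub z : N z \subset [set y | e z y].
  by apply/subsetP => y; rewrite !inE => /andP[].
apply: (@leq_trans (\sum_(z in [set z | d z == t.+1]) #|N z|)).
  apply: leq_card_witness => y /walked_pred[z ezy dz].
  by exists z; rewrite // inE dz.
rewrite (bigID (mem (jumped t.+1))) /= addnC mulnC -sum_nat_const -sum1_card.
apply: leq_add.
  rewrite (eq_bigl (mem (walked t.+1))) => [|z]; last first.
    by rewrite [RHS]in_setD andbC.
  (* One of the at most two path edges at [z] goes back to [y], outside layer [t.+2], so the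
     inclusion is proper. *)
  apply: leq_sum => z zW; have [y eyz dy] := walked_pred _ _ zW.
  rewrite -ltnS; apply: leq_trans (e_deg z); apply: proper_card.
  apply/properP; split=> //; exists y; first by rewrite inE e_sym.
  by rewrite !inE dy; lia.
rewrite (eq_bigl (mem (jumped t.+1))) => [|z]; last first.
  by rewrite !inE andbA andbb.
apply: leq_sum => z _; apply: leq_trans (e_deg z).
exact: subset_leq_card.
Qed.

(** Each jumped vertex lies on a new edge, and no new edge has both ends jumped: each end would be
    farther from [x] than the other. *)
Lemma card_jumped_le (t : nat) : \sum_(i < t) #|jumped i| <= k.
Proof.
pose J := [set y | y \in jumped (d y)].
have jumped_d i y : y \in jumped i -> d y = i.
  by case/jumpedP=> z [_ -> ->].
apply: (@leq_trans #|J|).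
  under eq_bigr do rewrite -sum1_card.
  rewrite (exchange_big_dep (mem J)) /= => [|i y _ yi]; last first.
    by rewrite inE (jumped_d _ _ yi).
  rewrite -sum1_card; apply: leq_sum => y _; rewrite sum1_card.
  apply/card_le1_eqP => i j /jumped_d yi /jumped_d yj.
  by apply: val_inj; rewrite /= -yi -yj.
case/and3P: F_matching => /eqP <- _ _.
apply: (@leq_trans (\sum_(A in F) #|[set y in J | y \in A]|)).
  apply: leq_card_witness => y; rewrite inE => /jumpedP[z [zyF _ _]].
  by exists [set z; y]; rewrite // !inE eqxx orbT.
rewrite -sum1_card; apply: leq_sum => A AF.
have back y : y \in J -> y \in A -> exists2 z, A = [set z; y] & d y = (d z).+1.
  rewrite inE => /jumpedP[z [zyF dy _]] yA; exists z => //.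
  by apply: (matching_unique y); rewrite // !inE eqxx orbT.
apply/card_le1_eqP => y y'; rewrite in_set => /andP[yJ yA].
rewrite in_set => /andP[yJ' yA'].
have [z Az dy] := back y yJ yA; have [z' Az' dy'] := back y' yJ' yA'.
have : y' \in [set z; y] by rewrite -Az.
have : y \in [set z'; y'] by rewrite -Az'.
rewrite !inE => /orP[] /eqP // yz' /orP[] /eqP // yz.
by move: dy dy'; rewrite -yz -yz'; lia.
Qed.

(** The quantity [A t] of the overview. *)
Definition spread (t : nat) : nat := (\sum_(i < t.+1) #|jumped i|).+1.

Lemma spread0 : spread 0 = 1.
Proof. by rewrite /spread big_ord_recr big_ord0 /= jumped0 cards0. Qed.

Lemma spreadS (t : nat) : spread t.+1 = spread t + #|jumped t.+1|.
Proof. by rewrite /spread big_ord_recr. Qed.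

Lemma spread_le (t : nat) : spread t <= k.+1.
Proof. exact: card_jumped_le. Qed.

Lemma card_walked_le (t : nat) : #|walked t.+1| <= 2 * spread t.
Proof.
elim: t => [|t IH]; first by rewrite spread0 card_walked1.
by have := card_walkedSS t; rewrite spreadS; lia.
Qed.

(** The recursion reaches back two steps, so the induction carries two consecutive values; [2 ^ t]
    satisfies it with equality. *)
Lemma spread_le_exp (t : nat) : spread t <= 2 ^ t.
Proof.
have s1 : spread 1 <= 2.
  by rewrite spreadS spread0; have := card_jumpedS 0; have := card_walked0; lia.
suff: spread t <= 2 ^ t /\ spread t.+1 <= 2 ^ t.+1 by case.
elim: t => [|t [IH1 IH2]]; first by rewrite spread0.
split=> //; rewrite spreadS [2 ^ _]expnS.
have := card_jumpedS t.+1; have := card_walked_le t.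
by rewrite expnS in IH2 *; lia.
Qed.

(** Walked vertices of layer [t.+1] number at most [2 * spread t]; the jumped ones add up to
    [spread D], whose extra one pays for layer 0. *)
Lemma card_le_spread (D : nat) : (forall y, d y <= D) ->
  #|T| <= 2 * \sum_(t < D) spread t + spread D.
Proof.
move=> dD.
have -> : #|T| = \sum_(t < D.+1) #|[set y | d y == t]|.
  rewrite -sum1_card (partition_big (fun y => inord (d y) : 'I_D.+1) predT) //=.
  apply: eq_bigr => t _; rewrite -sum1_card; apply: eq_bigl => y.
  by rewrite inE -val_eqE /= inordK // ltnS.
elim: D {dD} => [|D IH].
  rewrite big_ord_recr !big_ord0 /= card_layer jumped0 cards0 spread0 !add0n.
  exact: card_walked0.
rewrite big_ord_recr [\sum_(_ < D.+1) spread _]big_ord_recr /= card_layer.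
have := spreadS D; have := card_walked_le D; move: IH.
set S := \sum_(_ < _) _; set S' := \sum_(_ < _) _; lia.
Qed.

End Layers.

(** * The path graph *)

Lemma path_graph_sym (n : nat) : symmetric (@path_graph n).
Proof. by move=> i j; rewrite /path_graph orbC. Qed.

Lemma path_graph_deg (n : nat) (i : 'I_n) : #|[set j | path_graph i j]| <= 2.
Proof.
have sub1 (P : nat -> bool) m : (forall j, P j -> j = m) ->
    #|[set j : 'I_n | P j]| <= 1.
  move=> Pm; apply/card_le1_eqP => j l; rewrite !inE => /Pm jm /Pm lm.
  by apply/val_inj; rewrite /= jm lm.
have -> : [set j | path_graph i j] =
    [set j : 'I_n | i.+1 == j] :|: [set j : 'I_n | j.+1 == i].
  by apply/setP => j; rewrite !inE.
apply: leq_trans (leq_card_setU _ _) _; rewrite -[2]/(1 + 1) leq_add //.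
  by apply: (sub1 (fun j => i.+1 == j) i.+1) => j /eqP.
by apply: (sub1 (fun j => j.+1 == i) i.-1) => j /eqP <-.
Qed.

Lemma path_graph_reach (n : nat) (F : {set {set 'I_n}}) (x y : 'I_n) :
  x = 0 :> nat -> connect (add_edges (@path_graph n) F) x y.
Proof.
move=> x0; case: y; elim=> [|i IH] iP.
  by rewrite (_ : Ordinal iP = x) ?connect0 //; apply: val_inj.
apply: connect_trans (IH (ltnW iP)) (connect1 _).
by rewrite /add_edges /path_graph /= eqxx.
Qed.

Lemma dist_le_diam (T : finType) (e : rel T) (x y : T) : dist e x y <= diam e.
Proof.
exact: leq_trans (leq_bigmax y) (leq_bigmax (F := fun x => \max_y dist e x y) x).
Qed.

(** * Summing a sequence that doubles up to a cap *)

Lemma sum_exp2_lt (A : nat -> nat) (s : nat) : (forall t, A t <= 2 ^ t) ->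
  \sum_(t < s) A t < 2 ^ s.
Proof.
move=> Age; elim: s => [|s IH]; first by rewrite big_ord0.
rewrite big_ord_recr /= expnS mul2n -addnn -addSn leq_add //.
Qed.

Lemma capped_doubling_sum (A : nat -> nat) (n K D : nat) :
  (forall t, A t <= 2 ^ t) -> (forall t, A t <= K) -> 0 < K ->
  2 * K <= n + 2 -> n <= 2 * \sum_(t < D) A t + A D ->
  n + 2 * K * trunc_log 2 K <= 2 * K * D + 4 * 2 ^ trunc_log 2 K.
Proof.
move=> A2 AK K0 Kn nA; set s := trunc_log 2 K.
have sK : 2 ^ s <= K by apply: trunc_logP.
have Ks : K < 2 * 2 ^ s by rewrite -expnS; apply: trunc_log_ltn.
have [Ds|sD] := ltnP D s.
  (* This case is contradictory: [n <= 3 * 2 ^ D - 2 < 2 * K - 2 <= n]. *)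
  have : 2 ^ D.+1 <= 2 ^ s by rewrite leq_exp2l.
  rewrite expnS; have := sum_exp2_lt _ D A2; have := A2 D; lia.
have sumA : \sum_(t < D) A t + K * s <= K * D + 2 ^ s.
  rewrite -(subnKC sD); elim: (D - s) => [|i IH].
    by rewrite addn0; have := sum_exp2_lt _ s A2; lia.
  rewrite addnS big_ord_recr /= mulnS; have := AK (s + i); move: IH.
  by set S := \sum_(_ < _) _; lia.
(* The last term [A D] costs at most [K < 2 * 2 ^ s]; with twice the [2 ^ s] of [sumA] this gives
   the factor 4. *)
by have := AK D; lia.
Qed.

(** * The binary logarithm and its integer part *)

Local Open Scope ring_scope.

(** The point [1 / y] is the convex combination of [1 / 2] and [1] with weight [2 - 2 / y] on
    [1 / 2]; concavity of [ln] applies there. *)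
Lemma log2_chord (R : realType) (y : R) : 1 <= y <= 2 ->
  log2 y <= 2 - 2 / y.
Proof.
move=> /andP[y1 y2].
have y0 : 0 < y by lra.
have l2 : 0 < ln (2 : R) by rewrite ln_gt0 //; lra.
have yV : y * y^-1 = 1 by rewrite divff ?gt_eqF.
have V0 : 0 < y^-1 by rewrite invr_gt0.
have V1 : y^-1 <= 1 by nra.
have V2 : 1 <= 2 * y^-1 by nra.
have t0 : 0 <= 2 - 2 / y by lra.
have t1 : 2 - 2 / y <= 1 by lra.
have h0 : 0 < 2^-1 :> R by lra.
have := @concave_ln R (Itv01 t0 t1) _ _ h0 ltr01.
rewrite !convRE /= ln1 mulr0 addr0 mulr1 lnV ?posrE ?ltr0n // /unstable.onem.
have -> : (2 - 2 / y) / 2 + (1 - (2 - 2 / y)) = y^-1 by field; rewrite gt_eqF.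
rewrite lnV ?posrE // mulrN lerN2 => le_ln.
by rewrite /log2 ler_pdivrMr.
Qed.

Lemma log2_expn (R : realType) (s : nat) : log2 ((2 ^ s)%:R : R) = s%:R.
Proof.
rewrite /log2 natrX lnXn ?ltr0n // -[RHS]mulr1 -[X in X / _]mulr_natl.
by rewrite -mulrA divff // gt_eqF // ln_gt0 // ltr1n.
Qed.

Lemma log2M (R : realType) (x y : R) : 0 < x -> 0 < y ->
  log2 (x * y) = log2 x + log2 y.
Proof. by move=> x0 y0; rewrite /log2 lnM ?posrE // mulrDl. Qed.

(** The chord bound at [y = K / 2 ^ s], which lies between 1 and 2. *)
Lemma log2_trunc_log_le (R : realType) (K : nat) : (0 < K)%N ->
  log2 K%:R <= (trunc_log 2 K)%:R + 2 - 2 * (2 ^ trunc_log 2 K)%:R / K%:R :> R.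
Proof.
move=> K0; set s := trunc_log 2 K.
have s0 : 0 < (2 ^ s)%:R :> R by rewrite ltr0n expn_gt0.
have Kr0 : 0 < K%:R :> R by rewrite ltr0n.
have Ky : K%:R = (2 ^ s)%:R * (K%:R / (2 ^ s)%:R) :> R by field; rewrite gt_eqF.
rewrite {1}Ky log2M ?divr_gt0 // log2_expn -addrA lerD2l.
have -> : 2 * (2 ^ s)%:R / K%:R = 2 / (K%:R / (2 ^ s)%:R) :> R.
  by field; rewrite !gt_eqF.
apply: log2_chord; rewrite ler_pdivlMr // mul1r ler_nat trunc_logP //=.
by rewrite ler_pdivrMr // -natrM ler_nat -expnS ltnW // trunc_log_ltn.
Qed.

Theorem theorem1 (R : realType) (n k : nat) (hn : (2 <= n)%N)
    (hk : (1 <= k)%N) (hkn : (k.*2 <= n)%N) (m : nat) (hm : is_M n k m) :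
  n%:R / (2 * (k + 1)%:R) + log2 (k + 1)%:R - 2 <= m%:R :> R.
Proof.
case: hm => -[F F_matching <-] _; set D := diam _; rewrite addn1.
have n0 : (0 < n)%N by apply: ltnW.
(* Layers are explored from an end of the path. *)
pose x : 'I_n := Ordinal n0.
have reach y := path_graph_reach n F x y (erefl _).
have sym := path_graph_sym n; have deg := path_graph_deg n.
have := card_le_spread _ _ _ _ _ sym deg F_matching reach D
  (fun y => dist_le_diam _ _ x y).
rewrite card_ord => /capped_doubling_sum-/(_ k.+1) bound.
have {bound} : (n + 2 * k.+1 * trunc_log 2 k.+1 <=
    2 * k.+1 * D + 4 * 2 ^ trunc_log 2 k.+1)%N.
  apply: bound => //; last by lia.
    by move=> t; apply: spread_le_exp sym deg F_matching reach t.
  by move=> t; apply: spread_le F_matching t.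
have := log2_trunc_log_le R k.+1 isT.
set s := trunc_log 2 k.+1; rewrite -(ler_nat R) natrD (natrD _ (_ * D)) !natrM.
set K : R := k.+1%:R; set P : R := (2 ^ s)%:R => log_le n_le.
have K0 : 0 < K by rewrite ltr0n.
have : n%:R / (2 * K) <= D%:R + 2 * P / K - s%:R.
  rewrite ler_pdivrMr ?mulr_gt0 //.
  have -> : (D%:R + 2 * P / K - s%:R) * (2 * K) =
      2 * K * D%:R + 4 * P - 2 * K * s%:R by field; rewrite gt_eqF.
  lra.
(* The rounding error [2 * P / K] is exactly the term subtracted in [log_le], so it cancels. *)
move: log_le; set a := n%:R / _; set b := log2 _; set c := 2 * P / K; lra.
Qed.
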